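(* Let $\Phi$ be an irreducible simply laced root system with simple roots $\{\alpha_i\mid i\in I\}$, Cartan matrix $A=(a_{ij})_{i,j\in I}$ and root lattice $Q=\mathbb{Z}\Phi$, with $\langle\alpha,\alpha\rangle=2$ for all $\alpha\in\Phi$. Let $\{c_i\mid i\in I\}$ be a collection of signs such that $c_i=-c_j$ whenever $i\neq j$ and $a_{ij}\neq0$, and let $\varepsilon_0\colon Q\times Q\to\{\pm1\}$ be given by $\varepsilon_0(\alpha,\beta)=\prod_{i,j\in I}c_i^{a_{ij}n_im_j}$ for $\alpha=\sum_in_i\alpha_i$, $\beta=\sum_jm_j\alpha_j$ with $n_i,m_j\in\mathbb{Z}$. Then there is a special Chevalley system $\mathcal{L}=\{e_\alpha\mid\alpha\in\Phi\}$ in the corresponding Lie algebra $\mathfrak{g}=\mathfrak{g}(\varepsilon_0)$ (defined in the context) such that $$[e_\alpha,e_\beta]=(-1)^{\vec{\rho}(\alpha,\beta)}(q_{\alpha,\beta}+1)e_{\alpha+\beta}\qquad\text{if }\alpha,\beta,\alpha+\beta\in\Phi,$$ where $\vec{\rho}(\alpha,\beta)=-\sum_{(i,j)\in\vec{\mathcal{I}}(A)}n_im_j$ for $\alpha=\sum_in_i\alpha_i$ and $\beta=\sum_jm_j\alpha_j$, and $\vec{\mathcal{I}}(A)$ is the set of all pairs $(i,j)\in I\times I$ with $i\neq j$, $a_{ij}\neq0$ and $c_i=-1$.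
   Context: Let $E$ be a finite-dimensional real vector space with positive-definite scalar product $\langle\;,\;\rangle$, and $\Phi\subseteq E$ an irreducible crystallographic (reduced) root system spanning $E$, with a fixed system of simple roots $\{\alpha_i\mid i\in I\}$, positive roots $\Phi^+$ and negative roots $\Phi^-$. Cartan matrix: $a_{ij}=2\langle\alpha_i,\alpha_j\rangle/\langle\alpha_i,\alpha_i\rangle$. ''Simply laced'' means that $A$ is symmetric. For $\alpha,\beta\in\Phi$ put $p_{\alpha,\beta}=\max\{m\geq0\mid\beta+m\alpha\in\Phi\}$ and $q_{\alpha,\beta}=\max\{m\geq0\mid\beta-m\alpha\in\Phi\}$. The algebra $\mathfrak{g}(\varepsilon)$: for a function $\varepsilon\colon Q\times Q\to\{\pm1\}$, let $\mathfrak{g}$ be the complex vector space with basis $\{h_i\mid i\in I\}\cup\{e_\alpha\mid\alpha\in\Phi\}$, let $\mathfrak{h}=\langle h_i\mid i\in I\rangle_{\mathbb{C}}$, and for $\alpha=\sum_i n_i\alpha_i\in\Phi$ put $h_\alpha=\sum_i n_ih_i$. Define a bilinear product $[\;,\;]\colon\mathfrak{g}\times\mathfrak{g}\to\mathfrak{g}$ by: $[h_i,h_j]=0$; $[h_i,e_\alpha]=-[e_\alpha,h_i]=\langle\alpha_i,\alpha\rangle e_\alpha$; $[e_\alpha,e_{-\alpha}]=\varepsilon(\alpha,-\alpha)h_\alpha$; $[e_\alpha,e_\beta]=0$ if $\alpha+\beta\notin\Phi\cup\{0\}$; $[e_\alpha,e_\beta]=\varepsilon(\alpha,\beta)e_{\alpha+\beta}$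 if $\alpha+\beta\in\Phi$. For $\varepsilon=\varepsilon_0$ this is a simple Lie algebra with Cartan subalgebra $\mathfrak{h}$, root system $\Phi$, root spaces $\mathfrak{g}_\alpha=\mathbb{C}e_\alpha$ and co-roots $h_\alpha$. For a simple complex Lie algebra $\mathfrak{g}$ with Cartan subalgebra $\mathfrak h$, root system $\Phi$, root spaces $\mathfrak{g}_\alpha$ and co-roots $h_\alpha$ ($h_i:=h_{\alpha_i}$), a collection $\mathcal{L}=\{e_\alpha\mid\alpha\in\Phi\}$ with $0\neq e_\alpha\in\mathfrak{g}_\alpha$ is a Chevalley system if $[e_\alpha,e_\beta]=\varepsilon(\alpha,\beta)(q_{\alpha,\beta}+1)e_{\alpha+\beta}$ with $\varepsilon(\alpha,\beta)\in\{\pm1\}$ whenever $\alpha,\beta,\alpha+\beta\in\Phi$. It is a special Chevalley system if moreover for each $i\in I$ we have $[e_{\alpha_i},e_{-\alpha_i}]=h_i$ and there is a sign $c_i\in\{\pm1\}$ such that $[e_{\alpha_i},e_\alpha]=c_i(q_{\alpha_i,\alpha}+1)e_{\alpha+\alpha_i}$ if $\alpha\in\Phi^+$ and $\alpha+\alpha_i\in\Phi$, and $[e_{-\alpha_i},e_\alpha]=c_i(p_{\alpha_i,\alpha}+1)e_{\alpha-\alpha_i}$ if $\alpha\in\Phi^-$ and $\alpha-\alpha_i\in\Phi$. *)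

(* Defs.v *)
From HB Require Import structures.
From mathcomp Require Import all_boot all_order all_algebra finmap.
From mathcomp Require Import sesquilinear.
From mathcomp Require Import classical_sets reals complex.

Set Implicit Arguments.
Unset Strict Implicit.
Unset Printing Implicit Defensive.

Import Order.TTheory GRing.Theory Num.Theory.
Local Open Scope ring_scope.

Definition is_sign (s : int) : Prop := s = 1 \/ s = -1.

(* The maximum of a nonempty bounded set of natural numbers; the default value
   0 is returned only when there is no maximum. *)
Definition nat_max (P : nat -> Prop) : nat :=
  xget 0%N [set m | P m /\ forall k, P k -> (k <= m)%N].

Section RootSystems.
Variables (R : realType) (E : vectType R) (form : {dot E for idfun}).
Variable Phi : {fset E}.
Implicit Types (x y : E).

Definition reflection x y : E := y - (2 * form x y / form x x) *: x.

Record root_system : Prop := RootSystem {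
  root_neq0 : 0 \notin Phi;
  root_span : <<enum_fset Phi>>%VS = fullv;
  root_reflection : {in Phi &, forall x y, reflection x y \in Phi};
  root_crystallographic :
    {in Phi &, forall x y, 2 * form x y / form x x \is a Num.int};
  root_reduced : {in Phi, forall x (t : R), t *: x \in Phi -> t = 1 \/ t = -1}
}.

Definition irreducible_roots : Prop :=
  Phi <> fset0 /\
  forall A B : {fset E}, Phi = (A `|` B)%fset ->
    {in A & B, forall x y, form x y = 0} -> A = fset0 \/ B = fset0.

Definition root_p x y : nat := nat_max (fun m => y + x *+ m \in Phi).
Definition root_q x y : nat := nat_max (fun m => y - x *+ m \in Phi).

Variables (l : nat) (Delta : l.-tuple E).

Record simple_roots : Prop := SimpleRoots {
  simple_basis : basis_of fullv Delta;
  simple_in_roots : {subset Delta <= Phi};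
  simple_signs : {in Phi, forall x, exists n : 'I_l -> int,
    x = \sum_i (n i)%:~R *: tnth Delta i /\
    ((forall i, 0 <= n i) \/ (forall i, n i <= 0))}
}.

(* The floor is exact on the root lattice, where all coordinates with respect
   to the simple roots are integers. *)
Definition zcoord (i : 'I_l) x : int := Num.floor (coord Delta i x).

Definition positive_root x : Prop :=
  x \in Phi /\ forall i, 0 <= coord Delta i x.
Definition negative_root x : Prop :=
  x \in Phi /\ forall i, coord Delta i x <= 0.

(* The floor is exact for a crystallographic root system. *)
Definition cartan (i j : 'I_l) : int :=
  Num.floor (2 * form (tnth Delta i) (tnth Delta j)
             / form (tnth Delta i) (tnth Delta i)).

Definition simply_laced : Prop := forall i j, cartan i j = cartan j i.

Variable c : 'I_l -> int.

Definition eps0 x y : int :=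
  \prod_i \prod_j c i ^ (cartan i j * zcoord i x * zcoord j y).

Definition oriented (i j : 'I_l) : bool :=
  [&& i != j, cartan i j != 0 & c i == -1].

Definition rho x y : int :=
  - \sum_i \sum_(j | oriented i j) zcoord i x * zcoord j y.

End RootSystems.

Section LieAlgebras.
Variables (K : fieldType) (V : vectType K).
Variable br : V -> V -> V.

Record lie_bracket : Prop := LieBracket {
  lie_bilinear : bilinear_for *:%R *:%R br;
  lie_alternating : forall x, br x x = 0;
  lie_jacobi : forall x y z, br x (br y z) + br y (br z x) + br z (br x y) = 0
}.

Record simple_lie : Prop := SimpleLie {
  simple_is_lie : lie_bracket;
  simple_nonabelian : exists x y, br x y != 0;
  simple_ideals : forall J : {vspace V},
    (forall x y, y \in J -> br x y \in J) -> J = 0%VS \/ J = fullv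
}.

Variable H : {vspace V}.

Record cartan_subalgebra : Prop := CartanSubalgebra {
  cartan_closed : {in H &, forall x y, br x y \in H};
  cartan_nilpotent : exists n, forall (s : n.-tuple V) x,
    {subset s <= H} -> x \in H -> foldr br x s = 0;
  cartan_self_normalizing : forall x, {in H, forall h, br x h \in H} -> x \in H
}.

Definition root_space (lam : V -> K) (x : V) : Prop :=
  {in H, forall h, br h x = lam h *: x}.

End LieAlgebras.

Section ChevalleySystems.
Variables (R : realType) (E : vectType R) (Phi : {fset E}).
Variables (V : vectType R[i]) (br : V -> V -> V) (H : {vspace V}).
(* [ev x h] is the value at h in H of the linear form on H with which the
   vector x of E is identified, and [co x] is the co-root of x in Phi. *)
Variables (ev : E -> V -> R[i]) (co : E -> V).

(* (V, br) is a simple Lie algebra with Cartan subalgebra H, whose root system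
   and co-roots are Phi and [co] through the identification [ev]. *)
Record simple_lie_with_roots : Prop := SimpleLieWithRoots {
  slr_simple : simple_lie br;
  slr_cartan : cartan_subalgebra br H;
  slr_additive : forall x y, {in H, forall h, ev (x + y) h = ev x h + ev y h};
  slr_injective : forall x, {in H, forall h, ev x h = 0} -> x = 0;
  slr_roots : forall lam : 'Hom(V, R[i]^o),
    (exists2 h, h \in H & lam h != 0) /\
      (exists2 v, v != 0 & root_space br H lam v) <->
    (exists2 x, x \in Phi & {in H, forall h, lam h = ev x h});
  slr_linear : {in Phi, forall x, exists lam : 'Hom(V, R[i]^o),
    {in H, forall h, ev x h = lam h}};
  slr_coroot : {in Phi, forall x, [/\ co x \in H, ev x (co x) = 2
    & exists u v, [/\ root_space br H (ev x) u, root_space br H (ev (- x)) v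
                    & br u v = co x]]}
}.

Record chevalley_system (e : E -> V) : Prop := ChevalleySystem {
  chev_ambient : simple_lie_with_roots;
  chev_root_vector :
    {in Phi, forall x, e x != 0 /\ root_space br H (ev x) (e x)};
  chev_bracket : {in Phi &, forall x y, x + y \in Phi ->
    exists s : int, is_sign s /\
      br (e x) (e y) = (s%:~R * (root_q Phi x y).+1%:R) *: e (x + y)}
}.

Variables (l : nat) (Delta : l.-tuple E).
Local Notation "'alpha_ i" := (tnth Delta i) (at level 8, i at level 2).

Record special_chevalley_system (e : E -> V) : Prop := SpecialChevalleySystem {
  schev_chevalley : chevalley_system e;
  schev_coroot : forall i, br (e 'alpha_i) (e (- 'alpha_i)) = co 'alpha_i;
  schev_sign : forall i, exists s : int, [/\ is_sign s,
    forall x, positive_root Phi Delta x -> x + 'alpha_i \in Phi ->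
      br (e 'alpha_i) (e x) =
        (s%:~R * (root_q Phi 'alpha_i x).+1%:R) *: e (x + 'alpha_i)
    & forall x, negative_root Phi Delta x -> x - 'alpha_i \in Phi ->
      br (e (- 'alpha_i)) (e x) =
        (s%:~R * (root_p Phi 'alpha_i x).+1%:R) *: e (x - 'alpha_i)]
}.

End ChevalleySystems.

Section Algebra.
Variables (R : realType) (E : vectType R) (form : {dot E for idfun}).
Variables (Phi : {fset E}) (l : nat) (Delta : l.-tuple E).
Local Notation "'alpha_ i" := (tnth Delta i) (at level 8, i at level 2).

(* Coordinates with respect to the basis {h_i} + {e_x | x in Phi}. *)
Definition galg : vectType R[i] := {ffun 'I_l + Phi -> R[i]^o}.

Definition hbase (i : 'I_l) : galg := [ffun u => (u == inl i)%:R].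

(* Equal to 0 if x is not a root. *)
Definition ebase (x : E) : galg :=
  [ffun u => if u is inr y then (val y == x)%:R else 0].

Definition gcartan : {vspace galg} := <<[seq hbase i | i <- enum 'I_l]>>%VS.

Definition gcoroot (x : E) : galg := \sum_i (coord Delta i x)%:C%C *: hbase i.

(* The value at h = \sum_i (h (inl i)) h_i of the linear form h_i |-> <alpha_i, x>. *)
Definition geval (x : E) (h : galg) : R[i] :=
  \sum_i (h : {ffun _ -> _}) (inl i) * (form 'alpha_i x)%:C%C.

Variable eps : E -> E -> int.

Definition bracket_base (u v : 'I_l + Phi) : galg :=
  match u, v with
  | inl _, inl _ => 0
  | inl i, inr y => (form 'alpha_i (val y))%:C%C *: ebase (val y)
  | inr x, inl i => - ((form 'alpha_i (val x))%:C%C *: ebase (val x))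
  | inr x, inr y =>
      if val x + val y == 0 then (eps (val x) (val y))%:~R *: gcoroot (val x)
      else if val x + val y \in Phi then
        (eps (val x) (val y))%:~R *: ebase (val x + val y)
      else 0
  end.

Definition bracket (a b : galg) : galg :=
  \sum_u \sum_v ((a : {ffun _ -> _}) u * (b : {ffun _ -> _}) v) *: bracket_base u v.

End Algebra.

(* Main.v *)
From HB Require Import structures.
Require Import Defs.
From mathcomp Require Import all_boot all_order all_algebra finmap.
From mathcomp Require Import sesquilinear.
From mathcomp Require Import classical_sets reals complex.
From mathcomp Require Import ring lra zify.
Import Order.TTheory GRing.Theory Num.Theory.
Local Open Scope ring_scope.

Set Implicit Arguments.
Unset Strict Implicit.
Unset Printing Implicit Defensive.

(** The basis vectors [ebase x] themselves form the required system.

    When all roots have squared length 2, the form takes only the values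
    -2, -1, 0, 1, 2 on pairs of roots, with the extreme values exactly on
    opposite and equal roots, and [x + y] is a root if and only if
    <x, y> = -1 ([root_form_cases], [root_add]).  So all root strings have
    length at most two and the factor q + 1 is always 1 ([root_q_eq0]).

    The function [eps0] is bimultiplicative on the root lattice, and because
    adjacent nodes carry opposite signs,
    eps0(x, y) eps0(y, x) = (-1)^<x, y> ([eps0_cocycle]).  In the defining
    product the diagonal exponents are even and every other nonzero Cartan
    integer is odd, so only the pairs (i, j) with i and j adjacent and
    c_i = -1 contribute: this gives eps0 = (-1)^rho ([eps0_rho]).  If one
    argument is a simple root, bimultiplicativity leaves
    eps0(alpha_i, x) = c_i^<alpha_i, x> ([eps0_simple]), and this is the sign
    rule of a special Chevalley system, with the given c_i.

    What remains is that the algebra is a simple Lie algebra with the expected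
    Cartan subalgebra and roots.  The Jacobi identity holds for any
    bimultiplicative sign function with the above symmetry: on root vectors,
    either two of the roots are opposite ([jacobiator_opp]), or the three roots
    add up to 0 ([jacobiator_sum0]), or their sum is a root and up to rotation
    they form a path x - y - z ([jacobiator_path]); otherwise every term is 0.
    For simplicity, the eigenvalue 2 of ad h_y occurs only on e_y, so
    a polynomial in ad h_y projects an ideal onto each root space
    ([ideal_root_component]); a nonzero ideal therefore contains a root vector,
    and irreducibility spreads it to all of them ([ideal_root_full]). *)

(** * Roots of squared length 2 *)

Lemma nat_max_eq0 (P : nat -> Prop) :
  P 0%N -> (forall m, (0 < m)%N -> ~ P m) -> nat_max P = 0%N.
Proof.
move=> P0 Pn; apply: xget_unique => [|m [Pm _]].
  split=> // -[//|k] /(Pn _ (ltn0Sn k)) [].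
by case: m Pm => // m /(Pn _ (ltn0Sn m)).
Qed.

Section RootForm.
Context {R : realType} {E : vectType R} {form : {dot E for idfun}} {Phi : {fset E}}.

Lemma dotC (x y : E) : form x y = form y x.
Proof. by rewrite hermC /= expr0 mul1r. Qed.

Lemma dotDl (x y z : E) : form (x + y) z = form x z + form y z.
Proof. by rewrite linearDl. Qed.

Lemma dotDr (x y z : E) : form z (x + y) = form z x + form z y.
Proof. by rewrite linearDr. Qed.

Lemma dotNl (x y : E) : form (- x) y = - form x y.
Proof. by rewrite linearNl. Qed.

Lemma dotNr (x y : E) : form x (- y) = - form x y.
Proof. by rewrite linearNr. Qed.

Lemma dot0r (x : E) : form x 0 = 0.
Proof. by rewrite linear0r. Qed.

Lemma dotZl a (x y : E) : form (a *: x) y = a * form x y.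
Proof. by rewrite linearZl_LR. Qed.

Lemma dotZr a (x y : E) : form x (a *: y) = a * form x y.
Proof. by rewrite linearZr_LR. Qed.

Lemma dot_suml (I : finType) (F : I -> E) y :
  form (\sum_i F i) y = \sum_i form (F i) y.
Proof. by rewrite linear_sumlz. Qed.

Lemma dot_sumr (I : finType) (F : I -> E) x :
  form x (\sum_i F i) = \sum_i form x (F i).
Proof. by rewrite linear_sumr. Qed.

Lemma dot_eq0 (x : E) : form x x = 0 -> x = 0.
Proof.
move=> fx; apply/eqP; apply: contraTT isT => /(neq0_dnorm_gt0 (s := form)).
by rewrite fx ltxx.
Qed.

Hypothesis hPhi : root_system form Phi.
Hypothesis hnorm : forall x, x \in Phi -> form x x = 2.

Lemma root_reflectionE x y : x \in Phi -> y \in Phi -> y - form x y *: x \in Phi.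
Proof.
move=> xP yP; have := root_reflection hPhi xP yP.
by rewrite /reflection hnorm // mulrAC divff ?mul1r // pnatr_eq0.
Qed.

Lemma root_opp x : x \in Phi -> - x \in Phi.
Proof.
move=> xP; have := root_reflectionE xP xP.
by rewrite hnorm // scaler_nat mulr2n opprD addrA subrr sub0r.
Qed.

Lemma root_form_int x y : x \in Phi -> y \in Phi ->
  exists n : int, form x y = n%:~R.
Proof.
move=> xP yP; have := root_crystallographic hPhi xP yP.
rewrite hnorm // mulrAC divff ?mul1r ?pnatr_eq0 // => /intrP[n ->]; by exists n.
Qed.

Lemma form_add x y : form (x + y) (x + y) = form x x + 2 * form x y + form y y.
Proof. by rewrite dotDl !dotDr (dotC y x); ring. Qed.

Lemma form_ge0 x : 0 <= form x x.
Proof.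
by have [->|/(neq0_dnorm_gt0 (s := form))/ltW//] := eqVneq x 0; rewrite linear0l.
Qed.

Lemma root_form_eqN2 x y : x \in Phi -> y \in Phi ->
  form x y = - 2 -> x + y = 0.
Proof.
by move=> xP yP fxy; apply: dot_eq0; rewrite form_add !hnorm // fxy; ring.
Qed.

Lemma root_form_eq2 x y : x \in Phi -> y \in Phi -> form x y = 2 -> x = y.
Proof.
move=> xP yP fxy; apply/eqP; rewrite -subr_eq0; apply/eqP.
by apply: root_form_eqN2 => //; [apply: root_opp | rewrite dotNr fxy].
Qed.

(** Integrality leaves finitely many values, since the squared lengths
    4 + 2 <x, y> of [x + y] and 4 - 2 <x, y> of [x - y] are nonnegative. *)
Lemma root_form_cases x y : x \in Phi -> y \in Phi ->
  y = - x \/ [\/ form x y = - 1, form x y = 0, form x y = 1 | y = x].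
Proof.
move=> xP yP; have [n fn] := root_form_int xP yP.
have := form_ge0 (x + y); have := form_ge0 (x - y).
rewrite !form_add dotNr dotNl dotNr opprK !hnorm // fn => h1 h2.
have {}h1 : n <= 2 by rewrite -(ler_int R); lra.
have {}h2 : - 2 <= n by rewrite -(ler_int R); lra.
have : n = -2 \/ n = -1 \/ n = 0 \/ n = 1 \/ n = 2 by lia.
move=> [|[|[|[|]]]] n_eq; move: fn; rewrite n_eq => fn.
- by left; apply/eqP; rewrite -addr_eq0 addrC root_form_eqN2.
- by right; constructor 1.
- by right; constructor 2.
- by right; constructor 3.
- by right; constructor 4; rewrite (root_form_eq2 xP yP).
Qed.

(** One direction compares lengths; in the other, [x + y] is the reflection of
    [y] in [x]. *)
Lemma root_add x y : x \in Phi -> y \in Phi -> (x + y \in Phi) = (form x y == - 1).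
Proof.
move=> xP yP; apply/idP/eqP => [xyP|fxy].
  by have := form_add x y; rewrite !hnorm //; lra.
by have := root_reflectionE xP yP; rewrite fxy scaleNr scale1r opprK addrC.
Qed.

Lemma root_addr_eq0 x y : x \in Phi -> x + y = 0 -> form x y = -2.
Proof. by move=> xP /eqP; rewrite addrC addr_eq0 => /eqP ->; rewrite dotNr hnorm. Qed.

Lemma root_addr_neq0 x y : x \in Phi -> - 2 < form x y -> x + y != 0.
Proof.
by move=> xP; apply: contraTneq => /(root_addr_eq0 xP) ->; rewrite ltxx.
Qed.

(** The squared length of [y - x *+ m] is 2 + 2 m + 2 m^2, which exceeds 2. *)
Lemma root_string_stops x y m : x \in Phi -> y \in Phi -> form x y = - 1 ->
  (0 < m)%N -> y - x *+ m \notin Phi.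
Proof.
move=> xP yP fxy m_gt0; apply/negP => /hnorm.
rewrite form_add dotNr dotNl dotNr opprK dotC.
rewrite -scaler_nat !(dotZl, dotZr) fxy !hnorm // => ?.
have mR_gt0 : (0 : R) < m%:R by rewrite ltr0n.
nra.
Qed.

Lemma root_q_eq0 x y : x \in Phi -> y \in Phi -> x + y \in Phi ->
  root_q Phi x y = 0%N.
Proof.
move=> xP yP; rewrite root_add // => /eqP fxy.
apply: nat_max_eq0 => [|m m_gt0]; first by rewrite mulr0n subr0.
exact/negP/root_string_stops.
Qed.

Lemma root_p_eq0 x y : x \in Phi -> y \in Phi -> y - x \in Phi ->
  root_p Phi x y = 0%N.
Proof.
move=> xP yP; rewrite addrC root_add ?root_opp // => /eqP fxy.
apply: nat_max_eq0 => [|m m_gt0]; first by rewrite mulr0n addr0.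
rewrite -[y + _]/(y + _) -[x *+ m]opprK -mulNrn.
exact/negP/root_string_stops/m_gt0/fxy/yP/root_opp.
Qed.

End RootForm.

(** * Signs and the function [eps0] *)

Lemma sign_unit (s : int) : is_sign s -> s \is a GRing.unit.
Proof. by case=> ->. Qed.

Lemma sign_sqr (s : int) : is_sign s -> s * s = 1.
Proof. by case=> ->. Qed.

Lemma sign_opp (s : int) : is_sign s -> is_sign (- s).
Proof. by case=> ->; [right | left]; rewrite ?opprK. Qed.

Lemma sign_mul (s t : int) : is_sign s -> is_sign t -> is_sign (s * t).
Proof. by case=> -> st; rewrite ?mul1r ?mulN1r //; apply: sign_opp. Qed.

Lemma sign_mul_inj (s t u : int) : is_sign s -> s * t = u -> t = s * u.
Proof. by move=> ss <-; rewrite mulrA sign_sqr // mul1r. Qed.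

Lemma signN1 : is_sign (- 1). Proof. by right. Qed.

Lemma sign_expD (s : int) m n : is_sign s -> s ^ (m + n) = s ^ m * s ^ n.
Proof. by move=> ss; rewrite exprzDr // sign_unit. Qed.

Lemma sign_expMl (s t n : int) : is_sign s -> is_sign t ->
  (s * t) ^ n = s ^ n * t ^ n.
Proof. by move=> ss st; rewrite exprzMl ?sign_unit. Qed.

Lemma sign_exp2 (s n : int) : is_sign s -> s ^ n * s ^ n = 1.
Proof. by move=> ss; rewrite -sign_expMl // sign_sqr // exp1rz. Qed.

Lemma sign_expN (s n : int) : is_sign s -> s ^ (- n) = s ^ n.
Proof.
move=> ss; rewrite -[LHS]mulr1 -(sign_exp2 n ss) mulrA -sign_expD //.
by rewrite addNr expr0z mul1r.
Qed.

Lemma sign_exp (s n : int) : is_sign s -> is_sign (s ^ n).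
Proof.
move=> ss; have := sign_exp2 n ss; move: (s ^ n) => t t2.
suff /orP[/eqP->|/eqP->] : (t == 1) || (t == - 1) by [left | right].
by rewrite -sqrf_eq1 expr2 t2.
Qed.

Lemma sign_exp_even (s n : int) : is_sign s -> s ^ (2 * n) = 1.
Proof. by move=> ss; rewrite mulr2n mulrDl mul1r sign_expD ?sign_exp2. Qed.

Lemma sign_expM_sign (s t n : int) : is_sign s -> is_sign t -> s ^ (t * n) = s ^ n.
Proof. by move=> ss [] ->; rewrite ?mul1r ?mulN1r ?sign_expN. Qed.

Lemma sign_exp_sum (I : finType) (P : pred I) (s : int) (F : I -> int) : is_sign s ->
  s ^ (\sum_(i | P i) F i) = \prod_(i | P i) s ^ F i.
Proof.
by move=> ss; apply: big_morph => [m n|]; rewrite ?expr0z // sign_expD.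
Qed.

Lemma sign_prod (I : finType) (P : pred I) (F : I -> int) :
  (forall i, is_sign (F i)) -> is_sign (\prod_(i | P i) F i).
Proof. by move=> sF; elim/big_ind: _ => [|s t|//]; [left | apply: sign_mul]. Qed.

Section RootCocycle.
Context {R : realType} {E : vectType R}.

(** A bimultiplicative sign function on the root lattice whose commutator is
    (-1)^<x, y>, recorded only through the values at roots that the bracket
    uses.  The values eps(x, x) stay free: in contrast with the cocycles
    normalized by eps(x, x) = (-1)^(<x, x>/2), [eps0] is 1 at a simple root. *)
Record root_cocycle (form : {dot E for idfun}) (Phi : {fset E})
    (eps : E -> E -> int) : Prop := RootCocycle {
  cocycle_sign : forall x y, is_sign (eps x y);
  cocycle_addl : {in Phi & &, forall x y z, eps (x + y) z = eps x z * eps y z};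
  cocycle_addr : {in Phi & &, forall x y z, eps z (x + y) = eps z x * eps z y};
  cocycle_oppl : {in Phi &, forall x y, eps (- x) y = eps x y};
  cocycle_oppr : {in Phi &, forall x y, eps x (- y) = eps x y};
  cocycle_skew : {in Phi &, forall x y, forall n : int, form x y = n%:~R ->
    eps x y * eps y x = (- 1) ^ n}
}.
End RootCocycle.

Section Eps0.
Context {R : realType} {E : vectType R} {form : {dot E for idfun}}.
Context {Phi : {fset E}} {l : nat} {Delta : l.-tuple E} {c : 'I_l -> int}.
Hypothesis hPhi : root_system form Phi.
Hypothesis hDelta : simple_roots Phi Delta.
Hypothesis hnorm : forall x, x \in Phi -> form x x = 2.
Hypothesis hsign : forall i, is_sign (c i).
Hypothesis hc : forall i j, i != j -> cartan form Delta i j != 0 -> c i = - c j.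

Local Notation alpha := (tnth Delta).
Local Notation a := (cartan form Delta).
Local Notation eps := (eps0 form Delta c).

Lemma simple_root i : alpha i \in Phi.
Proof. by apply: (simple_in_roots hDelta); apply: mem_tnth. Qed.

Lemma simple_free : free Delta.
Proof. exact: basis_free (simple_basis hDelta). Qed.

Lemma coord_simple i j : coord Delta i (alpha j) = (i == j)%:R.
Proof. by rewrite (tnth_nth 0) coord_free ?simple_free // eq_sym. Qed.

Lemma coord_sum x : x = \sum_i coord Delta i x *: alpha i.
Proof.
rewrite {1}(coord_basis (simple_basis hDelta) (memvf x)).
by apply: eq_bigr => i _; rewrite (tnth_nth 0).
Qed.

Lemma cartanE i j : form (alpha i) (alpha j) = (a i j)%:~R.
Proof.
rewrite /cartan hnorm ?simple_root // mulrAC divff ?pnatr_eq0 // mul1r.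
have [n ->] := root_form_int hPhi hnorm (simple_root i) (simple_root j).
by rewrite intrKfloor.
Qed.

Lemma cartanC i j : a i j = a j i.
Proof. by apply: (@intr_inj R); rewrite -!cartanE dotC. Qed.

Lemma cartan_diag i : a i i = 2.
Proof. by apply: (@intr_inj R); rewrite -cartanE hnorm ?simple_root. Qed.

(** The Cartan integers +-2 would make two distinct simple roots equal or
    opposite; for [eps0] only the parity of the others matters. *)
Lemma cartan_off_diag i j : i != j -> a i j = 0 \/ is_sign (a i j).
Proof.
move=> nij; have nij' : coord Delta i (alpha j) != 1.
  by rewrite coord_simple (negPf nij) eq_sym oner_eq0.
have nij'' : coord Delta i (alpha j) != - 1.
  by rewrite coord_simple (negPf nij) eq_sym oppr_eq0 oner_eq0.
have := root_form_cases hPhi hnorm (simple_root i) (simple_root j).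
rewrite cartanE => -[aij|[] aij].
- by move: nij''; rewrite aij linearN /= coord_simple !eqxx.
- by right; right; apply: (@intr_inj R).
- by left; apply: (@intr_inj R).
- by right; left; apply: (@intr_inj R).
- by move: nij'; rewrite aij coord_simple !eqxx.
Qed.

Lemma zcoordE i x : x \in Phi -> coord Delta i x = (zcoord Delta i x)%:~R.
Proof.
move=> /(simple_signs hDelta)[n [-> _]]; rewrite /zcoord.
suff -> : coord Delta i (\sum_j (n j)%:~R *: alpha j) = (n i)%:~R.
  by rewrite intrKfloor.
rewrite linear_sum (bigD1 i) //= linearZ /= coord_simple eqxx mulr1.
rewrite big1 ?addr0 // => j nij.
by rewrite linearZ /= coord_simple eq_sym (negPf nij) mulr0.
Qed.

Lemma zcoordN i x : x \in Phi -> zcoord Delta i (- x) = - zcoord Delta i x.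
Proof.
move=> xP; apply: (@intr_inj R).
by rewrite -zcoordE ?(root_opp hPhi) // linearN /= rmorphN /= -zcoordE.
Qed.

Lemma zcoordD i x y : x \in Phi -> y \in Phi ->
  zcoord Delta i (x + y) = zcoord Delta i x + zcoord Delta i y.
Proof.
by move=> xP yP; rewrite {1}/zcoord linearD /= !zcoordE // -rmorphD intrKfloor.
Qed.

Lemma zcoord_simple i j : zcoord Delta i (alpha j) = (i == j)%:R.
Proof. by apply: (@intr_inj R); rewrite -zcoordE ?simple_root // coord_simple; case: eqP. Qed.

Lemma eps0_sign x y : is_sign (eps x y).
Proof. by apply: sign_prod => i; apply: sign_prod => j; apply: sign_exp. Qed.

(** Matching the factors of the two double products pairs (i, j) in the first
    with (j, i) in the second, and turns each pair into
    (-1)^(a_ij n_i m_j). *)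
Lemma eps0_skew x y n : x \in Phi -> y \in Phi -> form x y = n%:~R ->
  eps x y * eps y x = (- 1) ^ n.
Proof.
move=> xP yP fxy.
have -> : n = \sum_i \sum_j a i j * zcoord Delta i x * zcoord Delta j y.
  apply: (@intr_inj R); rewrite -fxy {1}(coord_sum x) {1}(coord_sum y).
  rewrite dot_suml rmorph_sum; apply: eq_bigr => i _ /=.
  rewrite dot_sumr rmorph_sum; apply: eq_bigr => j _ /=.
  by rewrite dotZl dotZr cartanE !rmorphM /= -!zcoordE //; ring.
rewrite (sign_exp_sum _ _ signN1) /eps0 [X in _ * X]exchange_big /= -big_split.
apply: eq_bigr => i _; rewrite (sign_exp_sum _ _ signN1) -big_split.
apply: eq_bigr => j _ /=.
rewrite (cartanC j i) -!mulrA [zcoord _ j y * _]mulrC.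
have [<-|nij] := eqVneq i j.
  by rewrite cartan_diag (sign_exp_even _ signN1) !sign_exp_even.
have [->|aij] := eqVneq (a i j) 0; first by rewrite mul0r !expr0z.
(* Adjacent nodes have opposite signs, so the two factors multiply to a power
   of [- c j * c j = - 1]. *)
by rewrite -sign_expMl // (hc nij) // mulNr sign_sqr.
Qed.

Lemma eps0_cocycle : root_cocycle form Phi eps.
Proof.
split=> [x y|x y z xP yP zP|x y z xP yP zP|x y xP yP|x y xP yP|x y xP yP n].
- exact: eps0_sign.
- rewrite -big_split; apply: eq_bigr => i _; rewrite -big_split.
  apply: eq_bigr => j _ /=.
  by rewrite zcoordD // mulrDr mulrDl sign_expD.
- rewrite -big_split; apply: eq_bigr => i _; rewrite -big_split.
  apply: eq_bigr => j _ /=.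
  by rewrite zcoordD // mulrDr sign_expD.
- apply: eq_bigr => i _; apply: eq_bigr => j _.
  by rewrite zcoordN // mulrN mulNr sign_expN.
- apply: eq_bigr => i _; apply: eq_bigr => j _.
  by rewrite zcoordN // mulrN sign_expN.
- exact: eps0_skew.
Qed.

(** Negating the exponent does not change a sign, so the minus sign in front of
    [rho] and the signs of the off-diagonal Cartan integers disappear. *)
Lemma eps0_rho x y : eps x y = (- 1) ^ rho form Delta c x y.
Proof.
rewrite /rho sign_expN; last exact: signN1.
rewrite (sign_exp_sum _ _ signN1); apply: eq_bigr => i _.
rewrite (sign_exp_sum _ _ signN1) [RHS]big_mkcond; apply: eq_bigr => j _ /=.
rewrite -mulrA /oriented; have [<-|nij] /= := eqVneq i j.
  by rewrite cartan_diag sign_exp_even.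
have [->|aij] /= := eqVneq (a i j) 0; first by rewrite mul0r expr0z.
have [] := cartan_off_diag nij; first by move/eqP: aij.
move=> sa; rewrite sign_expM_sign //.
by case: (hsign i) => ->; rewrite ?eqxx // exp1rz.
Qed.

Lemma eps0_simple i x n : x \in Phi -> form (alpha i) x = n%:~R ->
  eps (alpha i) x = c i ^ n.
Proof.
move=> xP fx.
have -> : n = \sum_j a i j * zcoord Delta j x.
  apply: (@intr_inj R); rewrite -fx {1}(coord_sum x).
  rewrite dot_sumr rmorph_sum; apply: eq_bigr => j _ /=.
  by rewrite dotZr cartanE !rmorphM /= -!zcoordE // mulrC.
rewrite /eps0 (bigD1 i) //= [X in _ * X]big1 ?mulr1.
  rewrite (sign_exp_sum _ _ (hsign i)); apply: eq_bigr => j _.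
  by rewrite zcoord_simple eqxx mulr1.
move=> k nki; apply: big1 => j _.
by rewrite zcoord_simple (negPf nki) mulr0 mul0r expr0z.
Qed.

End Eps0.

(** * The Jacobi identity *)

Lemma addr_interchange3 (V : zmodType) (a b c a' b' c' : V) :
  (a + a') + (b + b') + (c + c') = (a + b + c) + (a' + b' + c').
Proof. by rewrite (addrACA a) (addrACA (a + b)). Qed.

Section Jacobi.
Context {R : realType} {E : vectType R} {form : {dot E for idfun}}.
Context {Phi : {fset E}} {eps : E -> E -> int}.
Hypothesis hPhi : root_system form Phi.
Hypothesis hnorm : forall x, x \in Phi -> form x x = 2.
Hypothesis heps : root_cocycle form Phi eps.

Lemma cocycle_skewN1 x y : x \in Phi -> y \in Phi -> form x y = - 1 ->
  eps y x = - eps x y.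
Proof.
move=> xP yP fxy; rewrite -mulrN1; apply: sign_mul_inj.
  exact: (cocycle_sign heps).
exact: (cocycle_skew heps xP yP (n := -1)).
Qed.

Context {K : comNzRingType} {iota : {rmorphism R -> K}} {V : lmodType K}.
Context {br : V -> V -> V} {h e : E -> V}.
Implicit Types (a b c : V).

(** The multiplication table of the algebra, for co-root elements [h x],
    additive in the vector [x], and root vectors [e x], extended by 0 outside
    the roots.  This extension merges the cases of the bracket of two root vectors:
    for opposite roots the term [e (x + y)] is [e 0 = 0], and if [x + y] is
    neither 0 nor a root both terms vanish. *)
Record structure_relations : Prop := StructureRelations {
  rel_linear_l : forall b, linear (br^~ b);
  rel_linear_r : forall a, linear (br a);
  rel_alternating : forall a, br a a = 0;
  rel_hD : {morph h : x y / x + y};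
  rel_off : forall x, x \notin Phi -> e x = 0;
  rel_hh : forall x y, br (h x) (h y) = 0;
  rel_he : forall x y, br (h x) (e y) = iota (form x y) *: e y;
  rel_ee : {in Phi &, forall x y, br (e x) (e y) =
    (eps x y)%:~R *: (e (x + y) + (x + y == 0)%:R *: h x)}
}.
Hypothesis hrel : structure_relations.

HB.instance Definition _ := bilinear_isBilinear.Build K V V V *:%R *:%R
  br (rel_linear_l hrel, rel_linear_r hrel).

Lemma bracket0r a : br a 0 = 0. Proof. exact: linear0r. Qed.
Lemma bracketDl a b c : br (a + b) c = br a c + br b c.
Proof. exact: linearDl. Qed.
Lemma bracketDr a b c : br a (b + c) = br a b + br a c.
Proof. exact: linearDr. Qed.
Lemma bracketNr a b : br a (- b) = - br a b. Proof. exact: linearNr. Qed.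
Lemma bracketZl k a b : br (k *: a) b = k *: br a b.
Proof. exact: linearZl_LR. Qed.
Lemma bracketZr k a b : br a (k *: b) = k *: br a b.
Proof. exact: linearZr_LR. Qed.

Lemma bracketC a b : br a b = - br b a.
Proof.
have := rel_alternating hrel (a + b); rewrite bracketDl !bracketDr.
by rewrite !(rel_alternating hrel) addr0 add0r => /eqP; rewrite addr_eq0 => /eqP.
Qed.

Lemma root_vector0 : e 0 = 0.
Proof. exact: (rel_off hrel (root_neq0 hPhi)). Qed.

Lemma coroot0 : h 0 = 0.
Proof. by have /eqP := rel_hD hrel 0 0; rewrite addr0 -subr_eq0 opprD addNKr oppr_eq0 => /eqP. Qed.

Definition jacobiator a b c := br a (br b c) + br b (br c a) + br c (br a b).

Lemma jacobiator_cycle a b c : jacobiator a b c = jacobiator b c a.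
Proof. by rewrite /jacobiator -addrA addrC. Qed.

Lemma jacobiator_linear b c : linear (fun a => jacobiator a b c).
Proof.
move=> k a a'; rewrite /jacobiator !(bracketDl, bracketDr, bracketZl, bracketZr) !scalerDr.
exact: addr_interchange3.
Qed.

Lemma jacobiator_hhh x y z : jacobiator (h x) (h y) (h z) = 0.
Proof. by rewrite /jacobiator !(rel_hh hrel) !bracket0r !addr0. Qed.

Lemma jacobiator_hhe x y z : jacobiator (h x) (h y) (e z) = 0.
Proof.
rewrite /jacobiator (rel_hh hrel) bracket0r addr0 [br (e z) _]bracketC.
rewrite bracketNr !(rel_he hrel) !bracketZr !(rel_he hrel).
by rewrite !scalerA mulrC subrr.
Qed.

Lemma bracket_coroot_ee x y z : y \in Phi -> z \in Phi ->
  br (h x) (br (e y) (e z)) = iota (form x (y + z)) *: br (e y) (e z).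
Proof.
move=> yP zP; rewrite (rel_ee hrel) // bracketZr bracketDr bracketZr.
rewrite (rel_hh hrel) (rel_he hrel) scaler0 addr0 scalerA mulrC -scalerA.
have [->|] := eqVneq; last by rewrite scale0r addr0.
by rewrite dot0r rmorph0 !scale0r.
Qed.

Lemma jacobiator_hee x y z : y \in Phi -> z \in Phi ->
  jacobiator (h x) (e y) (e z) = 0.
Proof.
move=> yP zP; rewrite /jacobiator bracket_coroot_ee // [br (e z) (h x)]bracketC.
rewrite bracketNr !(rel_he hrel) !bracketZr [br (e z) _]bracketC.
by rewrite dotDr rmorphD scalerDl /= scalerN addrK subrr.
Qed.

Lemma jacobiator_aab a b : jacobiator a a b = 0.
Proof.
rewrite /jacobiator (rel_alternating hrel) bracket0r addr0 [br b a]bracketC.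
by rewrite bracketNr subrr.
Qed.

Lemma bracket_ee_root x y : x \in Phi -> y \in Phi -> form x y = - 1 ->
  br (e x) (e y) = (eps x y)%:~R *: e (x + y).
Proof.
move=> xP yP fxy; rewrite (rel_ee hrel) //.
have /negPf -> : x + y != 0 by apply: (root_addr_neq0 hnorm xP); rewrite fxy; lra.
by rewrite scale0r addr0.
Qed.

Lemma bracket_ee_eq0 x y : x \in Phi -> y \in Phi -> x + y != 0 ->
  x + y \notin Phi -> br (e x) (e y) = 0.
Proof.
move=> xP yP /negPf xy0 xyP; rewrite (rel_ee hrel) // xy0 scale0r addr0.
by rewrite (rel_off hrel) ?scaler0.
Qed.

Lemma bracket_ee_gtN1 x y : x \in Phi -> y \in Phi -> - 1 < form x y ->
  br (e x) (e y) = 0.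
Proof.
move=> xP yP fxy; apply: bracket_ee_eq0 => //.
  by apply: (root_addr_neq0 hnorm xP); lra.
by rewrite (root_add hPhi hnorm) // gt_eqF.
Qed.

Lemma bracket_ee_opp x : x \in Phi ->
  br (e x) (e (- x)) = (eps x x)%:~R *: h x.
Proof.
move=> xP; rewrite (rel_ee hrel) ?(root_opp hPhi hnorm) // subrr eqxx scale1r.
by rewrite root_vector0 add0r (cocycle_oppr heps).
Qed.

(** If [z] is [x] or [- x], two arguments coincide.  Otherwise, with n = <x, z>,
    the bracket with [h x] contributes a multiple of -n, and
    for n = -1 or n = 1 exactly one of the other two terms is nonzero and
    cancels it; the value [eps x x] factors out, so it can be any sign. *)
Lemma jacobiator_opp x z : x \in Phi -> z \in Phi ->
  jacobiator (e x) (e (- x)) (e z) = 0.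
Proof.
move=> xP zP; have nxP := root_opp hPhi hnorm xP.
have [->|fxz] := root_form_cases hPhi hnorm xP zP.
  by rewrite jacobiator_cycle jacobiator_aab.
have [->|nzx] := eqVneq z x.
  by rewrite 2!jacobiator_cycle jacobiator_aab.
have {fxz} [znx fxz] : z + x != 0 /\ [\/ form x z = - 1, form x z = 0 | form x z = 1].
  split; last by case: fxz nzx => [->|->|->|->]; rewrite ?eqxx //;
    [constructor 1|constructor 2|constructor 3].
  rewrite addrC; apply: (root_addr_neq0 hnorm xP).
  by case: fxz nzx => [->|->|->|->]; rewrite ?eqxx // => _; lra.
have nxz : - x + z != 0 by rewrite addrC subr_eq0.
have exz := sign_sqr (cocycle_sign heps x z).
rewrite /jacobiator bracket_ee_opp // bracketZr (bracketC (e z) (h x)).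
rewrite (rel_he hrel).
have fzx : form z x = form x z by rewrite dotC.
case: fxz => fxz; rewrite fxz.
- rewrite (bracket_ee_gtN1 nxP zP) ?dotNl ?fxz; last by lra.
  rewrite (bracket_ee_root zP xP) ?fzx // bracket0r add0r bracketZr.
  have zxP : z + x \in Phi by rewrite (root_add hPhi hnorm) // fzx fxz.
  rewrite bracket_ee_root //; last by rewrite dotNl dotDr fxz hnorm //; ring.
  rewrite [- x + _]addrC addrK (cocycle_skewN1 xP zP fxz) (cocycle_oppl heps) //.
  rewrite (cocycle_addr heps) // [iota _]rmorphN rmorph1 scaleN1r opprK scalerA.
  by rewrite -scalerDl -intrM -intrD mulrA mulNr exz mulN1r addNr scale0r.
- rewrite (bracket_ee_gtN1 nxP zP) ?dotNl ?fxz; last by lra.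
  rewrite (bracket_ee_gtN1 zP xP) ?fzx ?fxz; last by lra.
  by rewrite !bracket0r rmorph0 scale0r oppr0 scaler0 !addr0.
- rewrite (bracket_ee_gtN1 zP xP) ?fzx ?fxz; last by lra.
  rewrite (bracket_ee_root nxP zP) ?dotNl ?fxz // bracket0r addr0 bracketZr.
  have zxP : - x + z \in Phi by rewrite (root_add hPhi hnorm) // dotNl fxz.
  rewrite bracket_ee_root //; last by rewrite dotDr dotNr fxz hnorm //; ring.
  rewrite addNKr (cocycle_oppl heps) // (cocycle_addr heps) // (cocycle_oppr heps) //.
  rewrite rmorph1 scale1r scalerN scalerA -scalerBl -intrM -intrB.
  by rewrite [eps x x * _]mulrC mulrA exz mul1r subrr scale0r.
Qed.

(** Each of the three terms is a multiple of some [h u]; bimultiplicativity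
    makes the three coefficients equal, and [h x + h y + h z = h 0]. *)
Lemma jacobiator_sum0 x y z : x \in Phi -> y \in Phi -> z \in Phi ->
  x + y + z = 0 -> jacobiator (e x) (e y) (e z) = 0.
Proof.
move=> xP yP zP xyz0.
have /eqP xyE : x + y == - z by rewrite -addr_eq0 xyz0.
have /eqP yzE : y + z == - x by rewrite -addr_eq0 addrC addrA xyz0.
have /eqP zxE : z + x == - y by rewrite -addr_eq0 -addrA addrC xyz0.
have nP := root_opp hPhi hnorm.
have fE u v w : u \in Phi -> v \in Phi -> w \in Phi -> u + v = - w -> form u v = - 1.
  by move=> uP vP wP uvE; apply/eqP; rewrite -(root_add hPhi hnorm) // uvE nP.
rewrite /jacobiator !bracket_ee_root ?(fE _ _ _ _ _ _ xyE) ?(fE _ _ _ _ _ _ yzE)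
  ?(fE _ _ _ _ _ _ zxE) //.
rewrite !bracketZr xyE yzE zxE !bracket_ee_opp // !scalerA -!intrM /=.
have zE : z = - (x + y) by rewrite xyE opprK.
have xyP : x + y \in Phi by rewrite xyE nP.
have -> : eps y z * eps x x = eps x x * eps y y * eps y x.
  by rewrite zE (cocycle_oppr heps) // (cocycle_addr heps) //; ring.
have -> : eps z x * eps y y = eps x x * eps y y * eps y x.
  by rewrite zE (cocycle_oppl heps) // (cocycle_addl heps) //; ring.
have -> : eps x y * eps z z = eps x x * eps y y * eps y x.
  rewrite zE (cocycle_oppl heps) ?(cocycle_oppr heps) //; last by rewrite -zE.
  rewrite (cocycle_addl heps) // !(cocycle_addr heps) //.
  rewrite -[RHS]mulr1 -(sign_sqr (cocycle_sign heps x y)); ring.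
by rewrite -!scalerDr -!(rel_hD hrel) xyz0 coroot0 scaler0.
Qed.

Lemma bracket_bracket_eq0 x y z : x \in Phi -> y \in Phi -> z \in Phi ->
  y + z != 0 -> x + y + z != 0 -> x + y + z \notin Phi ->
  br (e x) (br (e y) (e z)) = 0.
Proof.
rewrite -addrA => xP yP zP yz0 xyz0 xyzP.
have [yzP|yzP] := boolP (y + z \in Phi); last first.
  by rewrite (bracket_ee_eq0 yP) // bracket0r.
rewrite bracket_ee_root //; first by rewrite bracketZr bracket_ee_eq0 // scaler0.
by apply/eqP; rewrite -(root_add hPhi hnorm).
Qed.

(** The two nonzero terms both lie in the line of [e (x + y + z)]; rewriting
    them through [eps x y], [eps x z] and [eps y z] leaves opposite signs,
    because the orthogonal pair commutes and [y], [z] anticommute. *)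
Lemma jacobiator_path x y z : x \in Phi -> y \in Phi -> z \in Phi ->
  form x y = - 1 -> form y z = - 1 -> form z x = 0 ->
  jacobiator (e x) (e y) (e z) = 0.
Proof.
move=> xP yP zP fxy fyz fzx; have fxz : form x z = 0 by rewrite dotC.
have xyP : x + y \in Phi by rewrite (root_add hPhi hnorm) // fxy.
have yzP : y + z \in Phi by rewrite (root_add hPhi hnorm) // fyz.
rewrite /jacobiator (bracket_ee_gtN1 zP xP) ?fzx; last by lra.
rewrite bracket0r addr0 !bracket_ee_root //.
rewrite !bracketZr !bracket_ee_root //; first last.
- by rewrite dotDr fxy fxz addr0.
- by rewrite dotDr fzx [form z y]dotC fyz add0r.
rewrite !scalerA -!intrM [z + _]addrC -[x + y + z]addrA -scalerDl -intrD.
have [eyz ezx]: eps z y = - eps y z /\ eps x z = eps z x.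
  split; first exact: cocycle_skewN1.
  rewrite -[RHS]mulr1; apply: sign_mul_inj; first exact: cocycle_sign heps _ _.
  exact: (cocycle_skew heps zP xP (n := 0)).
rewrite !(cocycle_addr heps) // eyz ezx.
by rewrite [X in X%:~R](_ : _ = 0) ?scale0r //; ring.
Qed.

(** When no two of the roots are opposite and the sum is a root, comparing
    lengths gives <x, y> + <y, z> + <z, x> = -2 with all summands at least -1,
    so two summands are -1 and the third is 0. *)
Lemma jacobiator_eee x y z : x \in Phi -> y \in Phi -> z \in Phi ->
  jacobiator (e x) (e y) (e z) = 0.
Proof.
move=> xP yP zP.
have oppE (u v : E) : u + v = 0 -> v = - u.
  by move=> /eqP; rewrite addrC addr_eq0 => /eqP ->.
have [/oppE->|xy0] := eqVneq (x + y) 0; first exact: jacobiator_opp.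
have [/oppE->|yz0] := eqVneq (y + z) 0.
  by rewrite jacobiator_cycle jacobiator_opp.
have [/oppE->|zx0] := eqVneq (z + x) 0.
  by rewrite 2!jacobiator_cycle jacobiator_opp.
have [|xyz0] := eqVneq (x + y + z) 0; first exact: jacobiator_sum0.
have [xyzP|xyzP] := boolP (x + y + z \in Phi); last first.
  rewrite /jacobiator !bracket_bracket_eq0 ?addr0 //.
  - by rewrite -addrA addrC.
  - by rewrite -addrA addrC.
  - by rewrite addrC addrA.
  - by rewrite addrC addrA.
have fsum : form x y + form y z + form z x = - 2.
  have := hnorm xyzP; rewrite 2!form_add dotDl !hnorm // [form z x]dotC; lra.
have fE u v : u \in Phi -> v \in Phi -> u + v != 0 -> form u v = - 1 \/ 0 <= form u v.
  move=> uP vP uv0; case: (root_form_cases hPhi hnorm uP vP) => [vE|[] ff].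
  - by move: uv0; rewrite vE subrr eqxx.
  - by left.
  - by right; rewrite ff.
  - by right; rewrite ff.
  - by right; rewrite ff hnorm.
case: (fE x y xP yP xy0) => fxy; case: (fE y z yP zP yz0) => fyz;
  case: (fE z x zP xP zx0) => fzx; try (exfalso; lra).
- by apply: jacobiator_path => //; lra.
- by rewrite 2!jacobiator_cycle; apply: jacobiator_path => //; lra.
- by rewrite jacobiator_cycle; apply: jacobiator_path => //; lra.
Qed.

End Jacobi.

(** * Coordinates and the bracket *)

Section Coordinates.
Context {R : realType} {E : vectType R} {Phi : {fset E}} {l : nat}.
Implicit Types (a b : galg Phi l) (u v w : 'I_l + Phi).
Local Notation C := R[i].

Definition gcoord u a : C := (a : {ffun _ -> _}) u.

Definition gbase u : galg Phi l :=
  match u with inl i => hbase Phi i | inr y => ebase Phi l (val y) end.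

Lemma gcoord_linear u : linear_for *%R (gcoord u).
Proof. by move=> k a b; rewrite /gcoord !ffunE. Qed.

HB.instance Definition _ u :=
  GRing.isLinear.Build C (galg Phi l) C *%R (gcoord u) (gcoord_linear u).

Lemma gcoordD u a b : gcoord u (a + b) = gcoord u a + gcoord u b.
Proof. exact: linearD. Qed.

Lemma gcoordZ u k a : gcoord u (k *: a) = k * gcoord u a.
Proof. exact: linearZ. Qed.

Lemma galg_ext a b : (forall u, gcoord u a = gcoord u b) -> a = b.
Proof. by move=> ab; apply/ffunP. Qed.

Lemma gcoord_base u v : gcoord u (gbase v) = (u == v)%:R.
Proof. by case: u v => [i|x] [j|y]; rewrite /gcoord ffunE. Qed.

(** Stated along an injection [f] so as to serve for the full basis and for its
    two halves, the [hbase i] and the root vectors. *)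
Lemma gcoord_comb (I : finType) (f : I -> 'I_l + Phi) (t : I -> C) i :
  injective f -> gcoord (f i) (\sum_j t j *: gbase (f j)) = t i.
Proof.
move=> inj; transitivity (\sum_j t j * (i == j)%:R).
  rewrite linear_sum; apply: eq_bigr => j _ /=.
  by rewrite gcoordZ gcoord_base (inj_eq inj).
rewrite (bigD1 i) //= eqxx mulr1 big1 ?addr0 // => j nji.
by rewrite eq_sym (negPf nji) mulr0.
Qed.

Lemma gcoord_sum a : a = \sum_u gcoord u a *: gbase u.
Proof. by apply: galg_ext => u; rewrite (gcoord_comb (f := id)). Qed.

Lemma linear_gbase_eq0 (V : lmodType C) (f : galg Phi l -> V) :
  linear f -> (forall u, f (gbase u) = 0) -> forall a, f a = 0.
Proof.
move=> lin f0 a.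
pose F := GRing.isLinear.Build C (galg Phi l) V *:%R f lin.
pose g : {linear galg Phi l -> V} := HB.pack f F.
rewrite -[f a]/(g a) (gcoord_sum a) linear_sum big1 // => u _.
by rewrite linearZ /= [X in _ *: X]f0 scaler0.
Qed.

Lemma ebase_notin x : x \notin Phi -> ebase Phi l x = 0.
Proof.
move=> xP; apply/ffunP => -[i|y]; rewrite !ffunE //.
by case: eqP => // yx; move: xP; rewrite -yx (valP y).
Qed.

Lemma ebaseE x (xP : x \in Phi) : ebase Phi l x = gbase (inr [` xP]%fset).
Proof. by []. Qed.

End Coordinates.

Section Bracket.
Context {R : realType} {E : vectType R} {form : {dot E for idfun}}.
Context {Phi : {fset E}} {l : nat} {Delta : l.-tuple E} {eps : E -> E -> int}.
Implicit Types (a b : galg Phi l) (u v w : 'I_l + Phi).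

Local Notation alpha := (tnth Delta).
Local Notation V := (galg Phi l).
Local Notation br := (@bracket R E form Phi l Delta eps).
Local Notation bb := (@bracket_base R E form Phi l Delta eps).
Local Notation e := (ebase Phi l).
Local Notation h := (@gcoroot R E Phi l Delta).

Lemma bracket_linear_l b : linear (br^~ b).
Proof.
move=> k a a'; rewrite /bracket scaler_sumr -big_split; apply: eq_bigr => u _.
rewrite scaler_sumr -big_split; apply: eq_bigr => v _ /=.
by rewrite scalerA -scalerDl !ffunE; congr (_ *: _); rewrite /GRing.scale /=; ring.
Qed.

Lemma bracket_linear_r a : linear (br a).
Proof.
move=> k b b'; rewrite /bracket scaler_sumr -big_split; apply: eq_bigr => u _.
rewrite scaler_sumr -big_split; apply: eq_bigr => v _ /=.
by rewrite scalerA -scalerDl !ffunE; congr (_ *: _); rewrite /GRing.scale /=; ring.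
Qed.

HB.instance Definition _ := bilinear_isBilinear.Build R[i] V V V *:%R *:%R
  br (bracket_linear_l, bracket_linear_r).

Lemma bracket_suml I (r : seq I) (P : pred I) (F : I -> V) a :
  br (\sum_(i <- r | P i) F i) a = \sum_(i <- r | P i) br (F i) a.
Proof. exact: linear_sumlz. Qed.
Lemma bracket_sumr I (r : seq I) (P : pred I) (F : I -> V) a :
  br a (\sum_(i <- r | P i) F i) = \sum_(i <- r | P i) br a (F i).
Proof. exact: linear_sumr. Qed.

Lemma bracket_gbase u v : br (gbase u) (gbase v) = bb u v.
Proof.
rewrite /bracket (bigD1 u) //= (bigD1 v) //= -!/(gcoord _ _) !gcoord_base !eqxx.
rewrite mul1r scale1r big1 ?big1 ?addr0 // => [u' nu|v' nv].
  by apply: big1 => v' _; rewrite -!/(gcoord _ _) gcoord_base (negPf nu) mul0r scale0r.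
by rewrite -!/(gcoord _ _) gcoord_base (negPf nv) mulr0 scale0r.
Qed.

Lemma gcorootD x y : h (x + y) = h x + h y.
Proof.
rewrite /gcoroot -big_split; apply: eq_bigr => i _ /=.
by rewrite linearD /= rmorphD scalerDl.
Qed.

Lemma gcorootN x : h (- x) = - h x.
Proof.
rewrite /gcoroot -sumrN; apply: eq_bigr => i _ /=.
by rewrite linearN /= rmorphN scaleNr.
Qed.

Lemma bracket_hbase_ebase i x :
  br (hbase Phi i) (e x) = (form (alpha i) x)%:C%C *: e x.
Proof.
have [xP|xP] := boolP (x \in Phi); last by rewrite ebase_notin // linear0r scaler0.
by rewrite (ebaseE xP) -[hbase Phi i]/(gbase (inl i)) bracket_gbase.
Qed.

Lemma bracket_hbase i j : br (hbase Phi i) (hbase Phi j) = 0.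
Proof. by rewrite -[LHS]/(br (gbase (inl i)) (gbase (inl j))) bracket_gbase. Qed.

Hypothesis hPhi : root_system form Phi.
Hypothesis hDelta : simple_roots Phi Delta.
Hypothesis hnorm : forall x, x \in Phi -> form x x = 2.
Hypothesis heps : root_cocycle form Phi eps.

Lemma bracket_ebase x y : x \in Phi -> y \in Phi ->
  br (e x) (e y) = (eps x y)%:~R *: (e (x + y) + (x + y == 0)%:R *: h x).
Proof.
move=> xP yP; rewrite (ebaseE xP) (ebaseE yP) bracket_gbase /=.
case: eqP => [->|_]; first by rewrite ebase_notin ?(root_neq0 hPhi) // add0r scale1r.
rewrite scale0r addr0.
by case: ifP => // xyP; rewrite ebase_notin ?scaler0 ?xyP.
Qed.

Lemma gcoroot_simple i : h (alpha i) = hbase Phi i.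
Proof.
rewrite /gcoroot (bigD1 i) //= (coord_simple hDelta) eqxx scale1r big1 ?addr0 //.
by move=> j nji; rewrite (coord_simple hDelta) (negPf nji) scale0r.
Qed.

Lemma bracket_gcoroot x y : br (h x) (h y) = 0.
Proof.
rewrite bracket_suml big1 // => i _; rewrite bracket_sumr big1 // => j _.
by rewrite linearZl_LR linearZr_LR /= bracket_hbase !scaler0.
Qed.

Lemma bracket_gcoroot_ebase x y : br (h x) (e y) = (form x y)%:C%C *: e y.
Proof.
rewrite {2}(coord_sum hDelta x) dot_suml rmorph_sum.
rewrite scaler_suml /gcoroot bracket_suml; apply: eq_bigr => i _ /=.
by rewrite linearZl_LR /= bracket_hbase_ebase dotZl rmorphM scalerA.
Qed.

(** Covers the basis, as [hbase i] is the co-root of a simple root, while letting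
    the first kind range over all vectors, as [structure_relations] does. *)
Inductive galg_generator : V -> Prop :=
  | CorootGenerator x : galg_generator (h x)
  | RootGenerator x of x \in Phi : galg_generator (e x).

Lemma gbase_generator u : galg_generator (gbase u).
Proof.
case: u => [i|y] /=; first by rewrite -gcoroot_simple; constructor.
by constructor; apply: valP.
Qed.

Lemma bracket_base_skew u v : bb u v = - bb v u.
Proof.
case: u v => [i|[x xP]] [j|[y yP]] /=; rewrite ?oppr0 ?opprK //.
rewrite [y + x]addrC addr_eq0; case: eqP => [->|_].
  by rewrite gcorootN scalerN (cocycle_oppl heps) ?(cocycle_oppr heps).
have [|_] := boolP (x + y \in Phi); last by rewrite oppr0.
rewrite (root_add hPhi hnorm) // => /eqP fxy.
by rewrite (cocycle_skewN1 heps xP yP fxy) rmorphN scaleNr opprK.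
Qed.

Lemma bracket_alternating a : br a a = 0.
Proof.
suff /eqP : br a a = - br a a.
  by rewrite -addr_eq0 -mulr2n -scaler_nat scaler_eq0 pnatr_eq0 => /eqP.
rewrite /bracket {1}exchange_big -sumrN; apply: eq_bigr => u _ /=.
rewrite -sumrN; apply: eq_bigr => v _ /=.
by rewrite bracket_base_skew scalerN mulrC.
Qed.

(** The concrete algebra is an instance of the abstract multiplication table,
    with scalars embedded through the reals inside the complex numbers. *)
Lemma galg_relations :
  @structure_relations R E form Phi eps R[i] (real_complex R) V br h e.
Proof.
split.
- exact: bracket_linear_l.
- exact: bracket_linear_r.
- exact: bracket_alternating.
- exact: gcorootD.
- exact: ebase_notin.
- exact: bracket_gcoroot.
- exact: bracket_gcoroot_ebase.
- exact: bracket_ebase.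
Qed.

(** The jacobiator is linear in its first argument and invariant under rotation,
    so three extensions from the basis reduce it to generators. *)
Lemma bracket_jacobi a b c : br a (br b c) + br b (br c a) + br c (br a b) = 0.
Proof.
pose J := @jacobiator R[i] V br.
have lin := jacobiator_linear galg_relations.
have cyc := @jacobiator_cycle R[i] V br.
rewrite -[LHS]/(J a b c); move: a.
apply: linear_gbase_eq0 => [|u]; first exact: lin.
rewrite /J cyc; move: b.
apply: linear_gbase_eq0 => [|v]; first exact: lin.
rewrite cyc; move: c.
apply: linear_gbase_eq0 => [|w]; first exact: lin.
have hhe := jacobiator_hhe galg_relations.
have hee := jacobiator_hee galg_relations.
suff all3 A B D : galg_generator A -> galg_generator B -> galg_generator D ->
  @jacobiator R[i] V br A B D = 0 by apply: all3; apply: gbase_generator.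
case=> [x|x xP] [y|y yP] [z|z zP].
- exact: jacobiator_hhh galg_relations _ _ _.
- exact: hhe.
- rewrite 2!cyc; exact: hhe.
- exact: hee.
- rewrite cyc; exact: hhe.
- rewrite cyc; exact: hee.
- rewrite 2!cyc; exact: hee.
- exact: (jacobiator_eee hPhi hnorm heps galg_relations).
Qed.

Lemma bracket_lie : lie_bracket br.
Proof.
split; [split; [exact: bracket_linear_l | exact: bracket_linear_r] | |].
  exact: bracket_alternating.
exact: bracket_jacobi.
Qed.

End Bracket.

Section Simple.
Context {R : realType} {E : vectType R} {form : {dot E for idfun}}.
Context {Phi : {fset E}} {l : nat} {Delta : l.-tuple E} {eps : E -> E -> int}.
Implicit Types (a b : galg Phi l) (u v w : 'I_l + Phi).

Local Notation alpha := (tnth Delta).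
Local Notation V := (galg Phi l).
Local Notation br := (@bracket R E form Phi l Delta eps).
Local Notation e := (ebase Phi l).
Local Notation h := (@gcoroot R E Phi l Delta).
Local Notation H := (@gcartan R E Phi l).
Local Notation ev := (@geval R E form Phi l Delta).

Hypothesis hPhi : root_system form Phi.
Hypothesis hDelta : simple_roots Phi Delta.
Hypothesis hnorm : forall x, x \in Phi -> form x x = 2.
Hypothesis heps : root_cocycle form Phi eps.

Local Notation rel := (galg_relations hPhi hDelta hnorm heps).

(** * The Cartan subalgebra *)

Lemma hbase_in_cartan i : hbase Phi i \in H.
Proof. by apply/memv_span/map_f; rewrite mem_enum. Qed.

Lemma mem_gcartan a : (a \in H) <-> forall y, gcoord (inr y) a = 0.
Proof.
split=> [aH y|a0].
  pose s := in_tuple [seq hbase Phi i | i <- enum 'I_l].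
  rewrite (coord_span (X := s) aH) linear_sum big1 // => i _.
  have /mapP[j _ sj] : s`_i \in s by rewrite mem_nth.
  by rewrite linearZ /= [s`_i]sj (gcoord_base (inr y) (inl j)) mulr0.
rewrite (gcoord_sum a) memv_suml // => -[i|y] _; last first.
  by rewrite a0 scale0r mem0v.
exact/memvZ/hbase_in_cartan.
Qed.

Lemma gcoroot_in_cartan x : h x \in H.
Proof. by apply: memv_suml => i _; apply/memvZ/hbase_in_cartan. Qed.

Lemma cartan_sum a : a \in H -> a = \sum_i gcoord (inl i) a *: hbase Phi i.
Proof.
move=> /mem_gcartan a0; rewrite {1}(gcoord_sum a) big_sumType /=.
by rewrite [X in _ + X]big1 ?addr0 // => y _; rewrite a0 scale0r.
Qed.

Lemma bracket_cartan_ebase a x : a \in H -> br a (e x) = ev x a *: e x.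
Proof.
move=> aH; rewrite {1}(cartan_sum aH) bracket_suml /geval scaler_suml.
apply: eq_bigr => i _; rewrite linearZl_LR /= bracket_hbase_ebase scalerA.
reflexivity.
Qed.

Lemma bracket_cartan_hbase a i : a \in H -> br a (hbase Phi i) = 0.
Proof.
move=> aH; rewrite {1}(cartan_sum aH) bracket_suml big1 // => j _.
by rewrite linearZl_LR /= bracket_hbase scaler0.
Qed.

Lemma bracket_cartan a b : a \in H ->
  br a b = \sum_(y : Phi) (ev (val y) a * gcoord (inr y) b) *: e (val y).
Proof.
move=> aH; rewrite {1}(gcoord_sum b) big_sumType /= linearDr /=.
rewrite !bracket_sumr big1 ?add0r => [|i _]; last first.
  by rewrite linearZr_LR /= bracket_cartan_hbase // scaler0.
apply: eq_bigr => y _.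
by rewrite linearZr_LR /= bracket_cartan_ebase // scalerA mulrC.
Qed.

Lemma gcoord_bracket_cartan a b u : a \in H ->
  gcoord u (br a b) = if u is inr y then ev (val y) a * gcoord u b else 0.
Proof.
move=> aH; rewrite bracket_cartan //; case: u => [i|y].
  by rewrite linear_sum big1 // => y _; rewrite linearZ /= (gcoord_base _ (inr y)) mulr0.
apply: (gcoord_comb (f := inr) (fun z => ev (val z) a * gcoord (inr z) b)).
by move=> ? ? [].
Qed.

Lemma geval_gcoroot x y : ev x (h y) = (form y x)%:C%C.
Proof.
rewrite [in RHS](coord_sum hDelta y) dot_suml [RHS]rmorph_sum.
apply: eq_bigr => i _; rewrite dotZl [RHS]rmorphM; congr (_ * _).
apply: (gcoord_comb (f := inl) (fun j => (coord Delta j y)%:C%C)).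
by move=> ? ? [].
Qed.

Lemma gevalD x y a : ev (x + y) a = ev x a + ev y a.
Proof.
rewrite -big_split; apply: eq_bigr => i _ /=.
by rewrite dotDr rmorphD mulrDr.
Qed.

Lemma geval_linear x : linear (ev x : V -> R[i]^o).
Proof.
move=> k a b; rewrite /geval scaler_sumr -big_split; apply: eq_bigr => i _ /=.
by rewrite -!/(gcoord _ _) linearP mulrDl scalerAl.
Qed.

(** A combination of simple roots orthogonal to all simple roots has norm 0. *)
Lemma gram_inj (t : 'I_l -> R) :
  (forall j, \sum_i t i * form (alpha i) (alpha j) = 0) -> forall i, t i = 0.
Proof.
move=> t0; pose x := \sum_i t i *: alpha i.
have coordx i : coord Delta i x = t i.
  rewrite linear_sum (bigD1 i) //= linearZ /= (coord_simple hDelta) eqxx mulr1.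
  rewrite big1 ?addr0 // => j nji.
  by rewrite linearZ /= (coord_simple hDelta) eq_sym (negPf nji) mulr0.
have x0 : x = 0.
  apply: (dot_eq0 (form := form)); rewrite {2}/x dot_sumr big1 // => j _.
  rewrite dotZr /x dot_suml.
  under eq_bigr do rewrite dotZl.
  by rewrite t0 mulr0.
by move=> i; rewrite -coordx x0 linear0.
Qed.

Lemma cartan_nondegenerate a : a \in H -> (forall j, ev (alpha j) a = 0) -> a = 0.
Proof.
move=> aH a0.
have re0 := @gram_inj (fun i => complex.Re (gcoord (inl i) a)).
have im0 := @gram_inj (fun i => complex.Im (gcoord (inl i) a)).
rewrite (cartan_sum aH) big1 // => i _.
suff -> : gcoord (inl i) a = 0 by rewrite scale0r.
(* The Gram matrix is real, so real and imaginary parts are handled apart. *)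
apply/eqP; rewrite eq_complex; apply/andP; split; apply/eqP.
  apply: re0 => j; rewrite -[RHS](congr1 (@complex.Re R) (a0 j)) raddf_sum.
  apply: eq_bigr => k _; rewrite -/(gcoord _ _); case: (gcoord _ _) => p q /=.
  by rewrite mulr0 subr0.
apply: im0 => j; rewrite -[RHS](congr1 (@complex.Im R) (a0 j)) raddf_sum.
apply: eq_bigr => k _; rewrite -/(gcoord _ _); case: (gcoord _ _) => p q /=.
by rewrite mulr0 add0r.
Qed.

Lemma ebase_neq0 x : x \in Phi -> e x != 0.
Proof.
move=> xP; apply/eqP => /(congr1 (gcoord (inr [` xP]%fset))).
by rewrite ebaseE gcoord_base eqxx linear0 => /eqP; rewrite oner_eq0.
Qed.

Lemma ebase_root_space x : root_space br H (ev x) (e x).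
Proof. by move=> a aH; apply: bracket_cartan_ebase. Qed.

(** * Simplicity *)

Section Ideal.
Variable J : {vspace V}.
Hypothesis hJ : forall a b, b \in J -> br a b \in J.

Lemma ideal_bracket_l a b : a \in J -> br a b \in J.
Proof. by move=> aJ; rewrite (bracketC rel) memvN hJ. Qed.

(** By [root_form_cases], ad h_y has eigenvalue 2 exactly on [e y] among the basis
    vectors, and -2, -1, 0 or 1 on the others.  Hence t (t - 1) (t + 1) (t + 2),
    evaluated at t = ad h_y, annihilates all of them but [e y], which it
    multiplies by 2 * 1 * 3 * 4 = 24. *)
Lemma ideal_root_component a (y : Phi) : a \in J -> gcoord (inr y) a != 0 ->
  e (val y) \in J.
Proof.
move=> aJ ay; have yP := valP y.
pose ad_eig u : R := if u is inr z then form (val y) (val z) else 0.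
have shift k b : b \in J ->
    exists2 b', b' \in J & forall u, gcoord u b' = (ad_eig u + k)%:C%C * gcoord u b.
  move=> bJ; exists (br (h (val y)) b + k%:C%C *: b).
    by apply: memvD; [apply: hJ | apply: memvZ].
  move=> u; rewrite gcoordD gcoordZ gcoord_bracket_cartan ?gcoroot_in_cartan //.
  rewrite rmorphD mulrDl; congr (_ + _).
  by case: u => [i|z] /=; rewrite ?geval_gcoroot // rmorph0 mul0r.
have [b1 b1J b1E] := shift 0 a aJ.
have [b2 b2J b2E] := shift (- 1) b1 b1J.
have [b3 b3J b3E] := shift 1 b2 b2J.
have [b4 b4J b4E] := shift 2 b3 b3J.
have k0 : 24%:C%C * gcoord (inr y) a != 0 by rewrite mulf_neq0 // fmorph_eq0 pnatr_eq0.
rewrite -[e _]/(gbase (inr y)) -[gbase _](scalerK k0); apply: memvZ.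
suff <- : b4 = (24%:C%C * gcoord (inr y) a) *: gbase (inr y) by [].
apply: galg_ext => u; rewrite gcoordZ gcoord_base.
rewrite b4E b3E b2E b1E !mulrA -!rmorphM /=.
set p := _ * (ad_eig u + 0).
have -> : p = if u == inr y then 24 else 0.
  rewrite /p /ad_eig; case: u {p} => [i|z] /=; first by ring.
  have zP := valP z; have [zy|nzy] := eqVneq (inr z) (inr y : 'I_l + Phi).
    by case: zy => ->; rewrite hnorm //; ring.
  have [zE|[f|f|f|zE]] := root_form_cases hPhi hnorm yP zP.
  - by rewrite zE dotNr hnorm //; ring.
  - by rewrite f; ring.
  - by rewrite f; ring.
  - by rewrite f; ring.
  - by case/eqP: nzy; congr inr; apply: val_inj.
by case: eqVneq => [->|_]; rewrite ?mulr1 // rmorph0 mul0r mulr0.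
Qed.

Hypothesis hirr : irreducible_roots form Phi.

Lemma ideal_coroot x : x \in Phi -> e x \in J -> h x \in J.
Proof.
move=> xP xJ; have nxP := root_opp hPhi hnorm xP.
have := ideal_bracket_l (e (- x)) xJ.
rewrite (bracket_ee_opp hPhi hnorm heps rel) //.
case: (cocycle_sign heps x x) => ->; first by rewrite rmorph1 scale1r.
by rewrite rmorphN rmorph1 scaleN1r memvN.
Qed.

Lemma ideal_neighbour x y : x \in Phi -> e x \in J -> form x y != 0 -> e y \in J.
Proof.
move=> xP xJ fxy; have := ideal_bracket_l (e y) (ideal_coroot xP xJ).
rewrite bracket_gcoroot_ebase // => fJ.
have k0 : (form x y)%:C%C != 0 :> R[i] by rewrite fmorph_eq0.
by rewrite -[e y](scalerK k0) memvZ.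
Qed.

(** Roots whose root vectors lie in [J] are orthogonal to the others: if
    <x, y> is nonzero, [e x] in [J] forces [h x] and then [e y] into [J]. *)
Lemma ideal_root_full x : x \in Phi -> e x \in J -> J = fullv.
Proof.
move=> xP xJ; have [_ irr] := hirr.
pose A := [fset y in Phi | e y \in J]%fset.
pose B := [fset y in Phi | e y \notin J]%fset.
have AB : Phi = (A `|` B)%fset.
  by apply/fsetP => y; rewrite !inE -andb_orr orbN andbT.
have ortho : {in A & B, forall y z, form y z = 0}.
  move=> y z; rewrite !inE => /andP[yP yJ] /andP[_ zJ].
  apply/eqP; apply: contraNT zJ; exact: ideal_neighbour.
have [A0|B0] := irr A B AB ortho.
  have : x \in A by rewrite !inE xP.
  by rewrite A0 inE.
have allJ y : y \in Phi -> e y \in J.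
  move=> yP; apply: contraT => yJ.
  have : y \in B by rewrite !inE yP.
  by rewrite B0 inE.
apply/eqP; rewrite eqEsubv subvf; apply/subvP => a _.
rewrite (gcoord_sum a) memv_suml // => -[i|y] _; apply: memvZ.
  rewrite /= -(gcoroot_simple hDelta).
  by have aP := simple_root hDelta i; apply/ideal_coroot/allJ.
exact/allJ/valP.
Qed.

(** A nonzero element has a root component, or lies in the Cartan subalgebra and
    then acts on some root vector by a nonzero scalar. *)
Lemma ideal_trivial : J = 0%VS \/ J = fullv.
Proof.
have [->|J0] := eqVneq J 0%VS; [by left | right].
have aJ := memv_pick J; have a0 : vpick J != 0 by rewrite vpick0.
move: (vpick J) aJ a0 => a aJ a0.
have [/existsP[y ay]|/existsPn a_y] := boolP [exists y, gcoord (inr y) a != 0].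
  exact/ideal_root_full/(ideal_root_component aJ ay)/valP.
have aH : a \in H by apply/mem_gcartan => y; apply/eqP; move: (a_y y); rewrite negbK.
have [/existsP[j aj]|/existsPn a_j] := boolP [exists j, ev (alpha j) a != 0].
  have jP := simple_root hDelta j; apply: (ideal_root_full jP).
  have := ideal_bracket_l (e (alpha j)) aJ; rewrite bracket_cartan_ebase // => fJ.
  by rewrite -[e _](scalerK aj) memvZ.
case/eqP: a0; apply: cartan_nondegenerate => // j.
by apply/eqP; move: (a_j j); rewrite negbK.
Qed.

End Ideal.
End Simple.

(** * The Chevalley system *)

Section Chevalley.
Context {R : realType} {E : vectType R} {form : {dot E for idfun}}.
Context {Phi : {fset E}} {l : nat} {Delta : l.-tuple E} {eps : E -> E -> int}.
Implicit Types (a b : galg Phi l) (u v w : 'I_l + Phi).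

Local Notation alpha := (tnth Delta).
Local Notation V := (galg Phi l).
Local Notation br := (@bracket R E form Phi l Delta eps).
Local Notation e := (ebase Phi l).
Local Notation h := (@gcoroot R E Phi l Delta).
Local Notation H := (@gcartan R E Phi l).
Local Notation ev := (@geval R E form Phi l Delta).

Hypothesis hPhi : root_system form Phi.
Hypothesis hirr : irreducible_roots form Phi.
Hypothesis hDelta : simple_roots Phi Delta.
Hypothesis hnorm : forall x, x \in Phi -> form x x = 2.
Hypothesis heps : root_cocycle form Phi eps.

Local Notation rel := (galg_relations hPhi hDelta hnorm heps).

Lemma bracket_coroot_root_neq0 x : x \in Phi -> br (h x) (e x) != 0.
Proof.
move=> xP; rewrite bracket_gcoroot_ebase // hnorm // scaler_eq0.
by rewrite negb_or fmorph_eq0 pnatr_eq0 ebase_neq0.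
Qed.

Lemma galg_simple : simple_lie br.
Proof.
split; first exact: bracket_lie.
- have /fset0Pn[x xP] : Phi != fset0 by apply/eqP; case: hirr.
  by exists (h x), (e x); apply: bracket_coroot_root_neq0.
- by move=> J hJ; exact: (ideal_trivial hPhi hDelta hnorm heps hJ hirr).
Qed.

Lemma bracket_cartan_cartan a b : a \in H -> b \in H -> br a b = 0.
Proof.
move=> aH /mem_gcartan b0; apply: galg_ext => u.
rewrite gcoord_bracket_cartan // linear0.
by case: u => // y; rewrite b0 mulr0.
Qed.

(** Self-normalizing: bracketing with [h y] multiplies the [y]-component by
    -<y, y>, so that component must vanish. *)
Lemma galg_cartan : cartan_subalgebra br H.
Proof.
split.
- by move=> a b aH bH; rewrite bracket_cartan_cartan ?mem0v.
- exists 1%N => s a; case/tupleP: s => b s; rewrite (tuple0 s) /= => sH aH.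
  by apply: bracket_cartan_cartan => //; apply: sH; rewrite inE eqxx.
- move=> a aH; apply/mem_gcartan => y.
  have hH : h (val y) \in H := gcoroot_in_cartan _.
  have /mem_gcartan/(_ y)/eqP := aH _ hH.
  rewrite (bracketC rel) -scaleN1r gcoordZ gcoord_bracket_cartan //.
  rewrite geval_gcoroot // (hnorm (valP y)) !mulf_eq0 oppr_eq0 oner_eq0.
  by rewrite fmorph_eq0 pnatr_eq0 => /eqP.
Qed.

Lemma geval_form x : exists lam : 'Hom(V, R[i]^o), forall a, lam a = ev x a.
Proof.
pose F := GRing.isLinear.Build R[i] V R[i]^o *:%R (ev x) (geval_linear x).
pose g : {linear V -> R[i]^o} := HB.pack (ev x : V -> R[i]^o) F.
by exists (linfun g) => a; rewrite lfunE.
Qed.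

(** A weight vector with a nonzero [y]-component has weight [ev y]; one without
    root components lies in the Cartan subalgebra and has weight 0. *)
Lemma galg_weights (lam : 'Hom(V, R[i]^o)) :
  (exists2 a, a \in H & lam a != 0) /\
    (exists2 b, b != 0 & root_space br H lam b) <->
  (exists2 x, x \in Phi & {in H, forall a, lam a = ev x a}).
Proof.
split=> [[[a aH la] [b b0 lb]]|[x xP lx]].
  have [/existsP[y byN]|/existsPn bH] := boolP [exists y, gcoord (inr y) b != 0].
    exists (val y); first exact: valP.
    move=> c cH; have := congr1 (gcoord (inr y)) (lb c cH).
    by rewrite gcoord_bracket_cartan // gcoordZ => /(mulIf byN) ->.
  have {}bH : b \in H.
    by apply/mem_gcartan => y; apply/eqP; move: (bH y); rewrite negbK.
  have := lb a aH; rewrite bracket_cartan_cartan // => /esym/eqP.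
  by rewrite scaler_eq0 (negPf la) (negPf b0).
split.
  exists (h x); first exact: gcoroot_in_cartan.
  by rewrite lx ?gcoroot_in_cartan // geval_gcoroot // hnorm // fmorph_eq0 pnatr_eq0.
exists (e x); first exact: ebase_neq0.
by move=> a aH; rewrite lx // bracket_cartan_ebase.
Qed.

Lemma galg_coroot x : x \in Phi -> [/\ h x \in H, ev x (h x) = 2
  & exists u v : V, [/\ root_space br H (ev x) u, root_space br H (ev (- x)) v
                  & br u v = h x]].
Proof.
move=> xP; split; first exact: gcoroot_in_cartan.
  by rewrite geval_gcoroot // hnorm // rmorph_nat.
(* The bracket of [e x] and [e (- x)] is the co-root up to the sign [eps x x]. *)
exists ((eps x x)%:~R *: e x), (e (- x)); split.
- move=> a aH; rewrite (bracketZr rel) (ebase_root_space x aH).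
  by rewrite !scalerA mulrC.
- exact: ebase_root_space.
- rewrite (bracketZl rel) (bracket_ee_opp hPhi hnorm heps rel) // scalerA -intrM.
  by rewrite sign_sqr ?rmorph1 ?scale1r //; apply: (cocycle_sign heps).
Qed.

Lemma galg_with_roots : simple_lie_with_roots Phi br H ev h.
Proof.
split.
- exact: galg_simple.
- exact: galg_cartan.
- by move=> x y a _; apply: gevalD.
- move=> x x0; apply: (dot_eq0 (form := form)); apply/eqP.
  have := x0 (h x) (gcoroot_in_cartan x); rewrite geval_gcoroot // => /eqP.
  by rewrite fmorph_eq0.
- exact: galg_weights.
- by move=> x xP; have [lam lamE] := geval_form x; exists lam => a _; rewrite lamE.
- exact: galg_coroot.
Qed.

Lemma bracket_ee_string x y : x \in Phi -> y \in Phi -> x + y \in Phi ->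
  br (e x) (e y) = ((eps x y)%:~R * (root_q Phi x y).+1%:R) *: e (x + y).
Proof.
move=> xP yP xyP; rewrite (root_q_eq0 hPhi hnorm xP yP xyP) mulr1.
have /eqP fxy : form x y == - 1 by rewrite -(root_add hPhi hnorm).
exact: (bracket_ee_root hnorm rel xP yP fxy).
Qed.

Lemma galg_chevalley : chevalley_system Phi br H ev h e.
Proof.
split; first exact: galg_with_roots.
  by move=> x xP; split; [apply: ebase_neq0 | apply: ebase_root_space].
move=> x y xP yP xyP; exists (eps x y); split.
  exact: (cocycle_sign heps).
exact: bracket_ee_string.
Qed.

End Chevalley.

Theorem corollary3p10 (R : realType) (E : vectType R) (form : {dot E for idfun})
    (Phi : {fset E}) (l : nat) (Delta : l.-tuple E) (c : 'I_l -> int)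
    (hPhi : root_system form Phi)
    (hirr : irreducible_roots form Phi)
    (hDelta : simple_roots Phi Delta)
    (hsl : simply_laced form Delta)
    (hnorm : forall x, x \in Phi -> form x x = 2)
    (hsign : forall i, is_sign (c i))
    (hc : forall i j, i != j -> cartan form Delta i j != 0 -> c i = - c j) :
  let br := @bracket R E form Phi l Delta (eps0 form Delta c) in
  exists e : E -> galg Phi l,
    special_chevalley_system Phi br (@gcartan R E Phi l)
      (geval form Delta) (@gcoroot R E Phi l Delta) Delta e /\
    forall x y, x \in Phi -> y \in Phi -> x + y \in Phi ->
      br (e x) (e y) =
        ((-1) ^ rho form Delta c x y * (root_q Phi x y).+1%:R) *: e (x + y).
Proof.
have heps := eps0_cocycle hPhi hDelta hnorm hsign hc.
have rel := galg_relations hPhi hDelta hnorm heps.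
have alphaP i := simple_root hDelta i.
have nP := root_opp hPhi hnorm.
have string := bracket_ee_string hPhi hDelta hnorm heps.
exists (ebase Phi l); split; last first.
  move=> x y xP yP xyP; rewrite (string _ _ xP yP xyP).
  rewrite (eps0_rho hPhi hDelta hnorm hsign).
  by rewrite rmorphXz ?rmorphN1.
split; first exact: galg_chevalley.
- move=> i; rewrite (bracket_ee_opp hPhi hnorm heps rel (alphaP i)).
  rewrite (eps0_simple hPhi hDelta hnorm hsign (n := 2)) ?hnorm //.
  by rewrite (sign_exp_even 1 (hsign i)) scale1r.
- move=> i; exists (c i); split; first exact: hsign.
    move=> x [xP _]; rewrite addrC => xaP; rewrite (string _ _ (alphaP i) xP xaP).
    have /eqP fxa : form (tnth Delta i) x == - 1 by rewrite -(root_add hPhi hnorm).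
    (* The exponent is <alpha_i, x> = -1, and an inverse of a sign is itself. *)
    rewrite (eps0_simple hPhi hDelta hnorm hsign (n := -1)) //.
  move=> x [xP _] xaP; have nxaP : - tnth Delta i + x \in Phi by rewrite addrC.
  rewrite (string _ _ (nP _ (alphaP i)) xP nxaP).
  (* Both string lengths are 0: q for - alpha_i, and p for alpha_i. *)
  rewrite (root_q_eq0 hPhi hnorm (nP _ (alphaP i)) xP nxaP).
  rewrite (root_p_eq0 hPhi hnorm (alphaP i) xP xaP) addrC.
  rewrite (cocycle_oppl heps (alphaP i) xP).
  have /eqP : form (- tnth Delta i) x == - 1 by rewrite -(root_add hPhi hnorm) ?nP.
  rewrite dotNl => /oppr_inj fxa.
  rewrite (eps0_simple hPhi hDelta hnorm hsign (n := 1)) // expr1z.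
Qed.
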